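(* Let $G$ and $H$ be two graphs. Then $$\mathrm{DOM}(G\odot H)=\begin{cases}\mathrm{DOM}(H)\,n(G), & \text{if } \mathrm{DOM}(H+K_1)=\mathrm{DOM}(H),\\ \mathrm{DOM}(H)\,n(G)+\mathrm{DOM}(G), & \text{if } \mathrm{DOM}(H+K_1)=\mathrm{DOM}(H)+1.\end{cases}$$
   Context: Graphs are finite, simple and undirected (with at least one vertex); $n(G)$ denotes the order (number of vertices) of $G$. An orientation of $G$ is a digraph obtained by directing every edge of $G$ in exactly one of its two possible directions. In a digraph $D$ with vertex set $V(D)$ and arc set $A(D)$, a vertex $u$ dominates $v$ if $(u,v)\in A(D)$; a set $S\subseteq V(D)$ is a dominating set if every vertex of $V(D)\setminus S$ is dominated by some vertex of $S$; $\gamma(D)$ is the smallest cardinality of a dominating set of $D$. The orientable domination number of a graph $G$ is $\mathrm{DOM}(G)=\max\{\gamma(D): D \text{ is an orientation of } G\}$. The corona $G\odot H$ is the graph obtained from the disjoint union of $G$ and $n(G)$ copies of $H$, denoted $H_u$ for $u\in V(G)$, by joining each $u\in V(G)$ to all vertices of $H_u$. The join $G+H$ is the graph obtained from the disjoint union of $G$ and $H$ by connecting each vertex of $G$ with each vertex of $H$; $K_1$ is the one-vertex graph. *)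

(* Defs.v *)
From mathcomp Require Import all_boot.

Set Implicit Arguments.
Unset Strict Implicit.
Unset Printing Implicit Defensive.

Record sgraph := SGraph {
  vertex :> finType;
  adj : rel vertex;
  adj_sym : symmetric adj;
  adj_irr : irreflexive adj
}.

Definition nverts (G : sgraph) : nat := #|G|.

(* A digraph on the vertex type V is given by its set of arcs A : {set V * V}. *)
Definition is_orientation (G : sgraph) (A : {set G * G}) : bool :=
  [forall u, forall v,
     if adj u v then ((u, v) \in A) (+) ((v, u) \in A) else (u, v) \notin A].

Section Domination.
Variables (V : finType) (A : {set V * V}).

Definition dominating (S : {set V}) : bool :=
  [forall v, (v \notin S) ==> [exists u, (u \in S) && ((u, v) \in A)]].

Lemma dominatingT : dominating [set: V].
Proof. by apply/forallP=> v; rewrite in_setT. Qed.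

Definition gamma : nat := #|[arg min_(S < [set: V] | dominating S) #|S|]|.

End Domination.

Lemma orientation_exists (G : sgraph) :
  is_orientation [set p : G * G | adj p.1 p.2 && (enum_rank p.1 < enum_rank p.2)].
Proof.
apply/forallP=> u; apply/forallP=> v; rewrite !inE /= (adj_sym v u).
case: (boolP (adj u v)) => //= uv.
case: ltngtP => // /val_inj/enum_rank_inj eq_uv.
by rewrite eq_uv adj_irr in uv.
Qed.

Definition DOM (G : sgraph) : nat :=
  \max_(A : {set G * G} | is_orientation A) gamma A.

Section Join.
Variables G H : sgraph.

Definition join_adj (x y : G + H) : bool :=
  match x, y with
  | inl u, inl v => adj u v
  | inr a, inr b => adj a b
  | _, _ => true
  end.

Lemma join_adj_sym : symmetric join_adj.
Proof. by move=> [u|a] [v|b] //=; exact: adj_sym. Qed.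

Lemma join_adj_irr : irreflexive join_adj.
Proof. by move=> [u|a] /=; exact: adj_irr. Qed.

Definition graph_join : sgraph := SGraph join_adj_sym join_adj_irr.

End Join.

Definition K1_adj (x y : unit) : bool := false.

Lemma K1_adj_sym : symmetric K1_adj. Proof. by []. Qed.

Lemma K1_adj_irr : irreflexive K1_adj. Proof. by []. Qed.

Definition K1 : sgraph := SGraph K1_adj_sym K1_adj_irr.

Section Corona.
Variables G H : sgraph.

(* inl u is the vertex u of G, and inr (u, a) is the vertex a of the copy H_u. *)
Definition corona_adj (x y : G + G * H) : bool :=
  match x, y with
  | inl u, inl v => adj u v
  | inl u, inr (v, _) => u == v
  | inr (u, _), inl v => u == v
  | inr (u, a), inr (v, b) => (u == v) && adj a b
  end.

Lemma corona_adj_sym : symmetric corona_adj.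
Proof.
move=> [u|[u a]] [v|[v b]] /=; rewrite 1?(eq_sym u) //; first exact: adj_sym.
by rewrite adj_sym.
Qed.

Lemma corona_adj_irr : irreflexive corona_adj.
Proof. by move=> [u|[u a]] /=; rewrite adj_irr ?andbF. Qed.

Definition corona : sgraph := SGraph corona_adj_sym corona_adj_irr.

End Corona.

(* Main.v *)
Require Import Defs.
From mathcomp Require Import all_boot.

Set Implicit Arguments.
Unset Strict Implicit.

(** The corona is a union of copies of [H + K1], one for each vertex [u] of [G],
    whose apexes [u] together span [G]. Orientations restrict to induced
    subgraphs, and the union of dominating sets of subgraphs that cover all
    vertices is dominating, so DOM is subadditive over induced covers
    ([DOM_cover]). All upper bounds are instances of this: cover [H + K1] by [H]
    and [K1]; cover the corona by the [n(G)] copies of [H + K1], which is the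
    better choice when DOM does not grow in passing from [H] to [H + K1]; or
    cover it by [G] and the [n(G)] copies of [H].

    For the lower bounds, glue an orientation [C] of [G] with one copy of an
    orientation [B] of [H + K1] at each vertex of [G]. A dominating set of the
    result meets each copy in a trace that dominates at least the vertices of
    [H], since these have no neighbour outside their copy
    ([trace_base_dominating]).
    - Directing every edge of [B] between [H] and the apex towards the apex makes
      the apex useless for [H], so each trace has at least DOM(H) vertices.
    - If [B] has domination number d + 1, a trace has at least d vertices, because
      adding the apex to it gives a dominating set of [B]. The copies whose trace
      has more than d vertices form a dominating set of [C]: in any other copy the
      trace leaves the apex undominated, so the apex is dominated from a vertex of
      [G] in the set, and the trace at that vertex contains its apex, hence
      dominates [B] and has at least d + 1 vertices. Summing the traces
      yields d n(G) + DOM(G), and d is DOM(H) in the second case. *)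

(** * Optimal dominating sets and orientations *)

Lemma dominatingP (V : finType) (A : {set V * V}) (S : {set V}) :
  reflect (forall v, v \notin S -> exists2 u, u \in S & (u, v) \in A)
          (dominating A S).
Proof.
apply: (iffP forallP) => [domS v vNS | domS v].
  by have /existsP[u /andP[]] := implyP (domS v) vNS; exists u.
by apply/implyP=> /domS[u uS uv]; apply/existsP; exists u; rewrite uS.
Qed.

Lemma gamma_min (V : finType) (A : {set V * V}) (S : {set V}) :
  dominating A S -> gamma A <= #|S|.
Proof.
by rewrite /gamma; case: arg_minnP => [|T _ minT /minT]; first exact: dominatingT.
Qed.

Lemma gamma_attained (V : finType) (A : {set V * V}) :
  exists2 S, dominating A S & #|S| = gamma A.
Proof.
rewrite /gamma; case: arg_minnP => [|T domT _]; first exact: dominatingT.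
by exists T.
Qed.

Lemma orientationP (G : sgraph) (A : {set G * G}) :
  reflect (forall u v, if adj u v then ((u, v) \in A) (+) ((v, u) \in A)
                       else (u, v) \notin A)
          (is_orientation A).
Proof.
by apply: (iffP forallP) => [oA u v | oA u]; [exact: (forallP (oA u) v) | apply/forallP].
Qed.

Lemma gamma_le_DOM (G : sgraph) (A : {set G * G}) :
  is_orientation A -> gamma A <= DOM G.
Proof. by move=> oA; apply: (@leq_bigmax_cond _ _ (fun A => gamma A)). Qed.

Lemma DOM_attained (G : sgraph) :
  exists2 A : {set G * G}, is_orientation A & gamma A = DOM G.
Proof.
have : 0 < #|[pred A : {set G * G} | is_orientation A]|.
  by apply/card_gt0P; eexists; exact: orientation_exists.
by case/(eq_bigmax_cond (fun A => gamma A)) => A oA eqA; exists A; rewrite // /DOM eqA.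
Qed.

Lemma DOM_le_nverts (G : sgraph) : DOM G <= nverts G.
Proof.
by apply/bigmax_leqP=> A _; rewrite /nverts -cardsT; apply/gamma_min/dominatingT.
Qed.

(** * Induced covers *)

Definition induced_map (G K : sgraph) (f : G -> K) : Prop :=
  forall u v, adj (f u) (f v) = adj u v.

Definition restrict_arcs (V W : finType) (f : V -> W) (A : {set W * W}) :=
  [set p : V * V | (f p.1, f p.2) \in A].

Lemma restrict_orientation (G K : sgraph) (f : G -> K) (A : {set K * K}) :
  induced_map f -> is_orientation A -> is_orientation (restrict_arcs f A).
Proof.
by move=> fi /orientationP oA; apply/orientationP=> u v; rewrite !inE /= -fi.
Qed.

(** An optimal dominating set in each piece, for the restriction of a given
    orientation, together dominate the whole graph; pieces may overlap. *)
Lemma DOM_cover (K : sgraph) (I : finType) (F : I -> sgraph)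
    (f : forall i, F i -> K) :
  (forall i, induced_map (f i)) -> (forall y, exists i x, f i x = y) ->
  DOM K <= \sum_i DOM (F i).
Proof.
move=> fi fsurj; apply/bigmax_leqP=> A oA.
pose R i := restrict_arcs (f i) A.
have exT i : exists T, dominating (R i) T && (#|T| == gamma (R i)).
  by have [T domT cT] := gamma_attained (R i); exists T; rewrite domT cT /=.
pose T i := xchoose (exT i).
have domT i : dominating (R i) (T i) by case/andP: (xchooseP (exT i)).
have cardT i : #|T i| = gamma (R i) by case/andP: (xchooseP (exT i)) => _ /eqP.
pose S := \bigcup_i f i @: T i.
have mS i x : x \in T i -> f i x \in S.
  by move=> xT; apply/bigcupP; exists i => //; exact: imset_f.
have domS : dominating A S.
  apply/dominatingP=> y yNS; have [i [x eqy]] := fsurj y.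
  have xNT : x \notin T i by apply: contra yNS => xT; rewrite -eqy mS.
  have [z zT] := elimT (dominatingP _ _) (domT i) x xNT.
  by rewrite inE /= eqy => zA; exists (f i z); first exact: mS.
apply: leq_trans (gamma_min domS) _.
apply: leq_trans (_ : \sum_i #|f i @: T i| <= _).
  rewrite /S; elim/big_rec2: _ => [|i n U _ leU]; first by rewrite cards0.
  by rewrite (leq_trans (leq_card_setU _ _)) // leq_add2l.
apply: leq_sum => i _; rewrite (leq_trans (leq_imset_card _ _)) // cardT.
exact/gamma_le_DOM/restrict_orientation.
Qed.

(** * The cone over [H] *)

Section Cone.
Variable H : sgraph.
Local Notation cone := (graph_join H K1).
Local Notation apex := (inr tt : cone).

Definition base_dominating (B : {set cone * cone}) (T : {set cone}) : Prop :=
  forall a : H, (inl a : cone) \notin T ->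
    exists2 x, x \in T & (x, inl a : cone) \in B.

Lemma dominating_base (B : {set cone * cone}) (T : {set cone}) :
  dominating B T -> base_dominating B T.
Proof. by move/dominatingP=> domT a; exact: domT. Qed.

Lemma dominating_of_apex (B : {set cone * cone}) (T : {set cone}) :
  base_dominating B T -> apex \in T -> dominating B T.
Proof. by move=> bT apT; apply/dominatingP=> -[a|[]]; [exact: bT | rewrite apT]. Qed.

Lemma gamma_le_base (B : {set cone * cone}) (T : {set cone}) :
  base_dominating B T -> gamma B <= #|T|.+1.
Proof.
move=> bT; have domT : dominating B (apex |: T).
  apply: dominating_of_apex; last exact: setU11.
  move=> a; rewrite in_setU1 /= => /bT[x xT xa].
  by exists x => //; rewrite in_setU1 xT orbT.
apply: leq_trans (gamma_min domT) _.
by rewrite cardsU1; case: (apex \in T); rewrite ?add1n.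
Qed.

Definition sink_arcs (A : {set H * H}) : {set cone * cone} :=
  [set p | match p.1, p.2 with
           | inl a, inl b => (a, b) \in A
           | inl _, inr _ => true
           | inr _, _ => false
           end].

Lemma sink_orientation (A : {set H * H}) :
  is_orientation A -> is_orientation (sink_arcs A).
Proof.
move/orientationP=> oA; apply/orientationP.
by move=> [a|[]] [b|[]]; rewrite !inE //=; exact: oA.
Qed.

(** The apex has no out-arcs here, so dominating the base without leaving it is
    no harder than dominating it with the help of the apex. *)
Lemma gamma_le_sink (A : {set H * H}) (T : {set cone}) :
  base_dominating (sink_arcs A) T -> gamma A <= #|T|.
Proof.
move=> bT; have domA : dominating A [set a | (inl a : cone) \in T].
  apply/dominatingP=> a; rewrite inE => /bT[[b|[]] bIT]; rewrite inE //= => ba.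
  by exists b; rewrite // inE.
apply: leq_trans (gamma_min domA) _.
rewrite -(card_imset _ (@inl_inj H unit)); apply/subset_leq_card/subsetP=> x.
by case/imsetP=> a; rewrite inE => aT ->.
Qed.

Lemma DOM_le_cone : DOM H <= DOM cone.
Proof.
have [A oA <-] := DOM_attained H.
have [T domT cardT] := gamma_attained (sink_arcs A).
apply: leq_trans (gamma_le_sink (dominating_base domT)) _.
by rewrite cardT; exact/gamma_le_DOM/sink_orientation.
Qed.

Lemma DOM_cone_le : DOM cone <= DOM H + 1.
Proof.
pose F (b : bool) := if b then H else K1.
pose f b : F b -> cone := if b return F b -> cone then @inl H K1 else @inr H K1.
have := @DOM_cover cone bool F f; rewrite big_bool /= => cover.
apply: leq_trans (cover _ _) _; first by case.
  by move=> [a|t]; [exists true, a | exists false, t].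
by rewrite leq_add2l (leq_trans (DOM_le_nverts K1)) // /nverts card_unit.
Qed.

End Cone.

(** * The corona as a union of cones *)

Section CoronaDomination.
Variables G H : sgraph.
Local Notation cone := (graph_join H K1).

Definition cone_at (u : G) (x : cone) : corona G H :=
  match x with inl a => inr (u, a) | inr _ => inl u end.

Lemma cone_at_induced (u : G) : induced_map (cone_at u).
Proof. by move=> [a|[]] [b|[]] /=; rewrite ?eqxx ?adj_irr. Qed.

Lemma cone_at_inj : injective (fun p : G * cone => cone_at p.1 p.2).
Proof. by move=> [u [a|[]]] [v [b|[]]] //= [->] // ->. Qed.

Lemma DOM_corona_le_cones : DOM (corona G H) <= DOM cone * nverts G.
Proof.
have := @DOM_cover (corona G H) G (fun=> cone) cone_at.
rewrite sum_nat_const mulnC; apply; first exact: cone_at_induced.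
by move=> [u|[u a]]; [exists u, (inr tt) | exists u, (inl a)].
Qed.

Lemma DOM_corona_le_base : DOM (corona G H) <= DOM H * nverts G + DOM G.
Proof.
pose F (i : G + unit) := if i is inl _ then H else G.
pose f i : F i -> corona G H :=
  match i return F i -> corona G H with
  | inl u => fun a => inr (u, a)
  | inr _ => fun u => inl u
  end.
apply: leq_trans (@DOM_cover (corona G H) _ F f _ _) _.
- by case=> [u|[]] x y //=; rewrite eqxx.
- by move=> [u|[u a]]; [exists (inr tt), u | exists (inl u), a].
by rewrite big_sumType /= !sum_nat_const card_unit mul1n mulnC.
Qed.

Section Gluing.
Variables (C : {set G * G}) (B : {set cone * cone}).

Definition glue_arcs : {set corona G H * corona G H} :=
  [set p | match p.1, p.2 with
           | inl u, inl v => (u, v) \in C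
           | inl u, inr (v, b) => (u == v) && ((inr tt, inl b) \in B)
           | inr (u, a), inl v => (u == v) && ((inl a, inr tt) \in B)
           | inr (u, a), inr (v, b) => (u == v) && ((inl a, inl b) \in B)
           end].

Lemma glue_orientation :
  is_orientation C -> is_orientation B -> is_orientation glue_arcs.
Proof.
move=> /orientationP oC /orientationP oB; apply/orientationP.
move=> [u|[u a]] [v|[v b]]; rewrite !inE /= ?(eq_sym v); first exact: oC.
- by case: eqP => //= _; exact: (oB (inr tt) (inl b)).
- by case: eqP => //= _; exact: (oB (inl a) (inr tt)).
- by case: eqP => //= _; exact: (oB (inl a) (inl b)).
Qed.

Definition trace (S : {set corona G H}) (u : G) : {set cone} :=
  cone_at u @^-1: S.

Lemma sum_card_trace S : \sum_u #|trace S u| <= #|S|.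
Proof.
pose X := [set p : G * cone | cone_at p.1 p.2 \in S].
have -> : \sum_u #|trace S u| = #|X|.
  rewrite -sum1dep_card -(pair_big_dep xpredT (fun u x => cone_at u x \in S)
    (fun _ _ => 1)) /=.
  by apply: eq_bigr => u _; rewrite -sum1dep_card.
rewrite -(card_imset _ cone_at_inj); apply/subset_leq_card/subsetP=> y.
by case/imsetP=> p; rewrite inE => pS ->.
Qed.

(** The in-neighbours of a vertex of [H_u] all lie in the cone at [u]. *)
Lemma trace_base_dominating S u :
  dominating glue_arcs S -> base_dominating B (trace S u).
Proof.
move=> /dominatingP domS a; rewrite inE /= => /domS[[v|[v b]] vS].
  by rewrite inE /= => /andP[/eqP eqv va]; exists (inr tt); rewrite // inE -eqv.
by rewrite inE /= => /andP[/eqP eqv ba]; exists (inl b); rewrite // inE -eqv.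
Qed.

Lemma gamma_glue_ge d :
  (forall T, base_dominating B T -> d <= #|T|) -> d * nverts G <= gamma glue_arcs.
Proof.
move=> minB; have [S domS <-] := gamma_attained glue_arcs.
apply: leq_trans (sum_card_trace S); rewrite mulnC -sum_nat_const.
by apply: leq_sum => u _; exact/minB/trace_base_dominating.
Qed.

Lemma gamma_glue_ge_add d :
  gamma B = d.+1 -> d * nverts G + gamma C <= gamma glue_arcs.
Proof.
move=> gB; have [S domS <-] := gamma_attained glue_arcs.
have bS u := @trace_base_dominating S u domS.
pose T := [set u | d < #|trace S u|].
have SsubT v : inl v \in S -> v \in T.
  move=> vS; rewrite inE -gB; apply/gamma_min/dominating_of_apex; first exact: bS.
  by rewrite inE.
have domT : dominating C T.
  apply/dominatingP=> u uNT.
  have uNS : inl u \notin S by apply: contra uNT; exact: SsubT.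
  have [[v|[v b]] vS] := elimT (dominatingP _ _) domS _ uNS; rewrite inE /=.
    by move=> vu; exists v; first exact: SsubT.
  (* An arc from H_u to u would make the trace at u dominate the whole cone. *)
  case/andP=> /eqP eqv bu; case/negP: uNT; rewrite inE -gB.
  apply/gamma_min/dominatingP=> -[a|[]]; first exact: bS.
  by exists (inl b); rewrite // inE /= -eqv.
apply: leq_trans (sum_card_trace S).
apply: leq_trans (_ : \sum_(u : G) (d + (u \in T)) <= _).
  rewrite big_split /= sum_nat_const mulnC leq_add2l.
  by rewrite -big_mkcond sum1_card; exact: gamma_min.
apply: leq_sum => u _; rewrite inE; case: ltnP => [|_]; first by rewrite addn1.
by rewrite addn0 -ltnS -gB; exact/gamma_le_base/bS.
Qed.

End Gluing.

Lemma DOM_corona_ge : DOM H * nverts G <= DOM (corona G H).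
Proof.
have [A oA <-] := DOM_attained H; have [C oC _] := DOM_attained G.
apply: leq_trans (@gamma_glue_ge C (sink_arcs A) _ _) _.
  by move=> T; exact: gamma_le_sink.
exact/gamma_le_DOM/glue_orientation/sink_orientation.
Qed.

Lemma DOM_corona_ge_add :
  DOM cone = (DOM H).+1 -> DOM H * nverts G + DOM G <= DOM (corona G H).
Proof.
have [C oC <-] := DOM_attained G; have [B oB <-] := DOM_attained cone.
move/(gamma_glue_ge_add C) => /leq_trans; apply.
exact/gamma_le_DOM/glue_orientation.
Qed.

End CoronaDomination.

(** * The formula *)

Unset Implicit Arguments.

Theorem theorem3p2 (G H : sgraph) (hG : 0 < nverts G) (hH : 0 < nverts H) :
  [/\ DOM (graph_join H K1) = DOM H \/ DOM (graph_join H K1) = DOM H + 1,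
      DOM (graph_join H K1) = DOM H ->
        DOM (corona G H) = DOM H * nverts G
    & DOM (graph_join H K1) = DOM H + 1 ->
        DOM (corona G H) = DOM H * nverts G + DOM G].
Proof.
split=> [|eqD|eqD].
- have := DOM_le_cone H; rewrite leq_eqVlt => /predU1P[-> | ltD]; first by left.
  by right; apply/eqP; rewrite eqn_leq DOM_cone_le addn1.
- by apply/eqP; rewrite eqn_leq DOM_corona_ge -{1}eqD DOM_corona_le_cones.
- apply/eqP; rewrite eqn_leq DOM_corona_le_base.
  by apply: DOM_corona_ge_add; rewrite eqD addn1.
Qed.
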